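(* The derivation of the expansion tableau is valid; that is: if $\mathbf{T}=(G,\mathcal{G},\mathcal{M},\mathcal{X},\simeq)$ is a valid matroid tableau, then its expansion tableau $[\mathbf{T}]_\simeq$ is a valid matroid tableau.
   Context: Matroids have finite ground sets. A digraph is a pair $D=(V,A)$ with $V$ finite and $A\subseteq V\times V$. A path in $D$ is a non-empty, non-repeating sequence of vertices $p_1p_2\ldots p_n$ with $(p_i,p_{i+1})\in A$ for $1\le i<n$. A routing from $X$ to $Y$ in $D$ is a family $R$ of paths in $D$ such that every $x\in X$ is the first vertex of some $p\in R$, every $p\in R$ ends in a vertex of $Y$, and any two distinct paths of $R$ are vertex-disjoint. For $E,T\subseteq V$, $\Gamma(D,T,E)$ is the matroid on $E$ whose independent sets are those $X\subseteq E$ for which there is a routing from $X$ to $T$ in $D$. A matroid $(E,\mathcal{I})$ is a gammoid if it equals $\Gamma(D,T,E)$ for some digraph $D=(V,A)$ with $E\subseteq V$ and some $T\subseteq V$; it is a strict gammoid if such a representation exists with $V=E$. A matroid tableau is a tuple $\mathbf{T}=(G,\mathcal{G},\mathcal{M},\mathcal{X},\simeq)$ where $G$ is a matroid (the goal), $\mathcal{G},\mathcal{M},\mathcal{X}$ are families of matroids, and $\simeq$ is an equivalence relation on $\{G'\mid G'\text{ is a minor of }G\}\cup\mathcal{G}\cup\mathcal{M}\cup\mathcal{X}$. The equivalence class of $M$ is denoted $[M]_\simeq$. $\mathbf{T}$ is valid if (i) all matroids in $\mathcal{G}$ are gammoids, (ii) no matroid in $\mathcal{M}$ is a strict gammoid,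 (iii) no matroid in $\mathcal{X}$ is a gammoid, and (iv) every equivalence class of $\simeq$ either consists only of gammoids or contains no gammoid. The expansion tableau of $\mathbf{T}$ is $[\mathbf{T}]_\simeq=(G,\mathcal{G}',\mathcal{M},\mathcal{X}',\simeq)$ with $\mathcal{G}'=\bigcup_{M\in\mathcal{G}}[M]_\simeq$ and $\mathcal{X}'=\bigcup_{M\in\mathcal{X}}[M]_\simeq$. *)

(* Defs.v *)
From mathcomp Require Import all_boot.
From mathcomp Require Import finmap.
From mathcomp Require Import boolp classical_sets.

Set Implicit Arguments.
Unset Strict Implicit.
Unset Printing Implicit Defensive.

Local Open Scope fset_scope.
Local Open Scope classical_set_scope.

(* [K] is the universe from which matroid elements and digraph vertices are
   drawn.  Since ground sets are genuine finite subsets of [K], the inclusion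
   E `<=` V and the equality of two matroids are literal.  When [K] is infinite
   there is no restriction on the number of auxiliary vertices of a digraph. *)

Record indep_system (K : choiceType) := IndepSystem {
  ground : {fset K};
  indep : set {fset K}
}.

Definition is_matroid (K : choiceType) (S : indep_system K) : Prop :=
  [/\ forall X : {fset K}, indep S X -> (X `<=` ground S)%fset,
      indep S fset0,
      forall X Y : {fset K}, indep S Y -> (X `<=` Y)%fset -> indep S X
    & forall X Y : {fset K}, indep S X -> indep S Y -> (#|` X| < #|` Y|)%N ->
        exists2 y : K, y \in (Y `\` X)%fset & indep S (y |` X)%fset].

Record matroid (K : choiceType) := Matroid {
  matroid_sys :> indep_system K;
  matroidP : is_matroid matroid_sys
}.

Definition deletion (K : choiceType) (S : indep_system K) (Z : {fset K}) :
    indep_system K :=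
  IndepSystem (ground S `\` Z)%fset
    [set X | (X `<=` ground S `\` Z)%fset /\ indep S X].

Definition is_basis_of (K : choiceType) (S : indep_system K) (B C : {fset K}) :
    Prop :=
  [/\ (B `<=` C)%fset, indep S B
    & forall B' : {fset K},
        indep S B' -> (B `<=` B')%fset -> (B' `<=` C)%fset -> B' = B].

(* In a matroid the choice of the basis of [C] is immaterial. *)
Definition contraction (K : choiceType) (S : indep_system K) (C : {fset K}) :
    indep_system K :=
  IndepSystem (ground S `\` C)%fset
    [set X | (X `<=` ground S `\` C)%fset /\
             exists2 B : {fset K}, is_basis_of S B C & indep S (X `|` B)%fset].

Definition is_minor (K : choiceType) (N M : matroid K) : Prop :=
  exists C Z : {fset K},
    [/\ (C `<=` ground M)%fset, (Z `<=` ground M)%fset, [disjoint C & Z]%fset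
      & N = deletion (contraction M C) Z :> indep_system K].

Record digraph (K : choiceType) := Digraph {
  vertices : {fset K};
  arcs : {fset K * K};
  arcs_sub : (arcs `<=` vertices `*` vertices)%fset
}.

Definition is_path (K : choiceType) (D : digraph K) (p : seq K) : bool :=
  [&& p != [::], uniq p, all (fun v => v \in vertices D) p
    & sorted (fun u v => (u, v) \in arcs D) p].

Definition is_routing (K : choiceType) (D : digraph K) (R : set (seq K))
    (X Y : {fset K}) : Prop :=
  [/\ forall p : seq K, R p -> is_path D p,
      forall x : K, x \in X -> exists q : seq K, R (x :: q),
      forall p : seq K, R p ->
        exists (q : seq K) (y : K), p = rcons q y /\ y \in Y
    & forall p q : seq K, R p -> R q -> p <> q ->
        forall v : K, v \in p -> v \notin q].

Definition Gamma (K : choiceType) (D : digraph K) (T E : {fset K}) :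
    indep_system K :=
  IndepSystem E
    [set X | (X `<=` E)%fset /\ exists R : set (seq K), is_routing D R X T].

Definition gammoid (K : choiceType) (M : matroid K) : Prop :=
  exists (D : digraph K) (T E : {fset K}),
    [/\ (E `<=` vertices D)%fset, (T `<=` vertices D)%fset
      & M = Gamma D T E :> indep_system K].

Definition strict_gammoid (K : choiceType) (M : matroid K) : Prop :=
  exists (D : digraph K) (T : {fset K}),
    (T `<=` vertices D)%fset /\
    M = Gamma D T (vertices D) :> indep_system K.

(* The bare tuple; that [tab_sim] is an equivalence relation on the required
   set of matroids is [is_tableau]. *)
Record tableau (K : choiceType) := Tableau {
  goal : matroid K;
  tab_G : set (matroid K);
  tab_M : set (matroid K);
  tab_X : set (matroid K);
  tab_sim : matroid K -> matroid K -> Prop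
}.

Definition tab_carrier (K : choiceType) (T : tableau K) : set (matroid K) :=
  [set N | is_minor N (goal T)] `|` tab_G T `|` tab_M T `|` tab_X T.

Definition equivalence_on (U : Type) (A : set U) (r : U -> U -> Prop) : Prop :=
  [/\ forall x y, r x y -> A x /\ A y,
      forall x, A x -> r x x,
      forall x y, r x y -> r y x
    & forall x y z, r x y -> r y z -> r x z].

Definition is_tableau (K : choiceType) (T : tableau K) : Prop :=
  equivalence_on (tab_carrier T) (tab_sim T).

Definition eq_class (K : choiceType) (T : tableau K) (M : matroid K) :
    set (matroid K) :=
  [set N | tab_sim T M N].

Definition valid (K : choiceType) (T : tableau K) : Prop :=
  [/\ forall M, tab_G T M -> gammoid M,
      forall M, tab_M T M -> ~ strict_gammoid M,
      forall M, tab_X T M -> ~ gammoid M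
    & forall M, tab_carrier T M ->
        (forall N, eq_class T M N -> gammoid N) \/
        ~ (exists2 N, eq_class T M N & gammoid N)].

Definition valid_tableau (K : choiceType) (T : tableau K) : Prop :=
  is_tableau T /\ valid T.

Definition expansion (K : choiceType) (T : tableau K) : tableau K :=
  {| goal := goal T;
     tab_G := \bigcup_(M in tab_G T) eq_class T M;
     tab_M := tab_M T;
     tab_X := \bigcup_(M in tab_X T) eq_class T M;
     tab_sim := tab_sim T |}.

(* Main.v *)
Require Import Defs.
From mathcomp Require Import all_boot.
From mathcomp Require Import classical_sets.

(** Classes of [tab_sim] are homogeneous: all gammoids or none. So a class meeting [tab_G] has only
    gammoids and one meeting [tab_X] has none, which makes the enlarged families sound. Since
    related matroids lie in the carrier, adding whole classes leaves [tab_carrier] unchanged, so the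
    equivalence and homogeneity conditions carry over. *)

Lemma tab_carrier_expansion (K : choiceType) (T : tableau K) :
  is_tableau T -> tab_carrier (expansion T) = tab_carrier T.
Proof.
move=> [simA sim_refl _ _]; apply/seteqP; split=> N.
- move=> [[[minorN|[M _ MN]]|MN]|[M _ MN]].
  + by left; left; left.
  + exact: (simA _ _ MN).2.
  + by left; right.
  + exact: (simA _ _ MN).2.
(* By reflexivity, members of [tab_G] and [tab_X] lie in their own classes, so none is lost. *)
- move=> TN; have NN := sim_refl _ TN.
  case: TN => [[[minorN|GN]|MN]|XN].
  + by left; left; left.
  + by left; left; right; exists N.
  + by left; right.
  + by right; exists N.
Qed.

Theorem lemma3p6 (K : choiceType) (T : tableau K) :
  valid_tableau T -> valid_tableau (expansion T).
Proof.
move=> [tabT [gamG nstrM ngamX homT]].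
have carrierE := tab_carrier_expansion _ _ tabT.
have [simA sim_refl sim_sym _] := tabT.
split; first by rewrite /is_tableau carrierE.
split=> //; last by move=> M; rewrite carrierE; apply: homT.
- move=> N [M GM MN]; have [AM _] := simA _ _ MN.
  have [/(_ N MN) //|no_gammoid] := homT _ AM.
  by case: no_gammoid; exists M; [apply: sim_refl | apply: gamG].
- move=> N [M XM MN] gamN; have [AM _] := simA _ _ MN.
  have [all_gammoid|no_gammoid] := homT _ AM.
  (* Here [M] itself would be a gammoid, although it is in [tab_X]. *)
  + by apply: (ngamX _ XM); apply/all_gammoid/sim_refl.
  + by apply: no_gammoid; exists N.
Qed.
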